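(* Let $S$ be a finite set, let $\mathcal{F}\subseteq 2^S$ be a nonempty family of subsets of $S$, and let $\{X_i\}_{i\in S}$ be i.i.d. non-negative random weights whose common distribution satisfies assumption $A(q)$ for some $q>0$. Given $\varepsilon>0$, let $L$ be such that $\Pr(M(\mathcal{F})\le L)\ge \varepsilon$. If $\mathcal{F}$ is $(r,\lambda,\varepsilon)$-patchable for some $r\ge \sqrt{8\log(\varepsilon^{-1})\cdot \ell(\mathcal{F})}$ and some $\lambda>0$, then with probability at least $1-2\varepsilon$, \[ M(\mathcal{F})\le \left(L^{\frac{q}{q+1}}+\lambda^{\frac{q}{q+1}}\right)^{\frac{q+1}{q}}. \] In particular, if (under the same patchability hypothesis) $m$ is the median of $M(\mathcal{F})$, $\varepsilon<1/4$ and $\lambda\le m$, then there is a constant $C=C(q)$ depending only on $q$ such that with probability at least $1-3\varepsilon$, \[ \frac{|M(\mathcal{F})-m|}{m}\le C\left(\frac{\lambda}{m}\right)^{\frac{q}{q+1}}. \]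
   Context: For $G\subseteq S$ write $X_G=\sum_{i\in G}X_i$. Define $M(\mathcal{F}):=\min_{F\in\mathcal{F}}X_F$ and $\ell(\mathcal{F}):=\max_{F\in\mathcal{F}}|F|$. The upward closure is $\langle\mathcal{F}\rangle=\{G\subseteq S:\exists F\in\mathcal{F},\ F\subseteq G\}$. For $G,P\subseteq S$, $P$ is a $G$-patch if $G\cup P\in\langle\mathcal{F}\rangle$. Let $\rho(G):=\min\{|P|: P \text{ is a } G\text{-patch}\}$ (the Hamming distance from $G$ to $\langle\mathcal{F}\rangle$), and $\mathcal{B}_r:=\{G\subseteq S:\rho(G)\le r\}$. The random variable $\mathrm{Patch}(G):=\min\{X_P: P\text{ is a }G\text{-patch}\}$. A (deterministic) set $G\subseteq S$ is $(\lambda,\varepsilon)$-patchable if $\Pr(\mathrm{Patch}(G)\le\lambda)\ge 1-\varepsilon$; the family $\mathcal{F}$ is $(r,\lambda,\varepsilon)$-patchable if every $G\in\mathcal{B}_r$ is $(\lambda,\varepsilon)$-patchable. Assumption $A(q)$: a random variable $X$ satisfies $A(q)$ if for every $s\in(0,1)$, $X$ can be coupled with two independent random variables $Y,Y'$, each with the same distribution as $X$, such that surely $X\le \min\left(\frac{Y}{(1-s)^{1/q}},\frac{Y'}{s^{1/q}}\right)$. *)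

(* Defs.v *)
From HB Require Import structures.
From mathcomp Require Export all_boot all_order all_algebra.
From mathcomp Require Export all_classical all_reals all_analysis.
Set Implicit Arguments.
Unset Strict Implicit.
Unset Printing Implicit Defensive.
Import Order.TTheory GRing.Theory Num.Theory.
Local Open Scope classical_set_scope.
Local Open Scope ring_scope.

(* The minimum of f over the nonempty set A; the value 0 for A empty is junk. *)
Definition min_over (R : realType) (I : finType) (A : {set I}) (f : I -> R) : R :=
  if [pick i in A] is Some i0 then \big[Num.min/f i0]_(i in A) f i else 0.

Section Families.
Variables (S : finType) (F : {set {set S}}).

Definition ell : nat := \max_(A in F) #|A|.

Definition upclosure : {set {set S}} :=
  [set G : {set S} | [exists A in F, A \subset G]]%SET.

Definition is_patch (G P : {set S}) : bool := (G :|: P)%SET \in upclosure.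

Definition patches (G : {set S}) : {set {set S}} :=
  [set P : {set S} | is_patch G P]%SET.

(* The default #|S| plays no role when F is nonempty: S is then a G-patch. *)
Definition rho (G : {set S}) : nat := \big[minn/#|S|]_(P in patches G) #|P|.

Definition patch_ball (R : realType) (r : R) : {set {set S}} :=
  [set G : {set S} | (rho G)%:R <= r]%SET.

End Families.

Section RandomWeights.
Context (R : realType) (d : measure_display) (T : measurableType d).
Variables (P : probability T R) (S : finType) (X : S -> {RV P >-> R}).

Definition weight (G : {set S}) (w : T) : R := \sum_(i in G) X i w.

Definition min_weight (F : {set {set S}}) (w : T) : R :=
  min_over F (fun A => weight A w).

Definition patch_cost (F : {set {set S}}) (G : {set S}) (w : T) : R :=
  min_over (patches F G) (fun Q => weight Q w).

Definition set_patchable (F : {set {set S}}) (lam eps : R) (G : {set S}) : Prop :=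
  ((1 - eps)%:E <= P [set w | (patch_cost F G w <= lam)%R])%E.

Definition family_patchable (F : {set {set S}}) (r lam eps : R) : Prop :=
  forall G, G \in patch_ball F r -> set_patchable F lam eps G.

Definition mutually_independent : Prop :=
  forall (J : {set S}) (B : S -> set R), (forall i, measurable (B i)) ->
    P (\bigcap_(i in [set` J]) (X i @^-1` B i)) =
    (\prod_(i in J) P (X i @^-1` B i))%E.

Definition is_median (Z : T -> R) (m : R) : Prop :=
  ((2^-1)%:E <= P [set w | (Z w <= m)%R])%E /\
  ((2^-1)%:E <= P [set w | (m <= Z w)%R])%E.

End RandomWeights.

Definition same_law (R : realType)
    (d : measure_display) (T : measurableType d) (P : probability T R)
    (d' : measure_display) (T' : measurableType d') (P' : probability T' R)
    (X : {RV P >-> R}) (X' : {RV P' >-> R}) : Prop :=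
  forall B : set R, measurable B -> distribution P X B = distribution P' X' B.

Definition independent2 (R : realType)
    (d : measure_display) (T : measurableType d) (P : probability T R)
    (Y Y' : {RV P >-> R}) : Prop :=
  forall B B' : set R, measurable B -> measurable B' ->
    P (Y @^-1` B `&` Y' @^-1` B') = (P (Y @^-1` B) * P (Y' @^-1` B'))%E.

(* The coupling lives on some probability space Q, with Z the copy of X in it. *)
Definition assumptionA (R : realType) (q : R)
    (d : measure_display) (T : measurableType d) (P : probability T R)
    (X : {RV P >-> R}) : Prop :=
  forall s : R, 0 < s < 1 ->
    exists (d' : measure_display) (T' : measurableType d')
           (Q : probability T' R) (Z Y Y' : {RV Q >-> R}),
      [/\ same_law Z X, same_law Y X, same_law Y' X, independent2 Y Y' &
          forall w, Z w <= Num.min (Y w / (1 - s) `^ q^-1) (Y' w / s `^ q^-1)].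

Definition iid_weights (R : realType) (q : R)
    (d : measure_display) (T : measurableType d) (P : probability T R)
    (S : finType) (X : S -> {RV P >-> R}) : Prop :=
  [/\ mutually_independent X,
      (forall i j, same_law (X i) (X j)),
      (forall i w, 0 <= X i w) &
      (forall i, assumptionA q (X i))].

(* Main.v *)
Require Import Defs.
From mathcomp Require Import all_boot all_order all_algebra.
From mathcomp Require Import all_classical all_reals all_analysis.
From mathcomp Require Import measurable_realfun ring lra.
Set Implicit Arguments.
Unset Strict Implicit.
Unset Printing Implicit Defensive.
Import Order.TTheory GRing.Theory Num.Theory.
Local Open Scope classical_set_scope.
Local Open Scope ring_scope.

(** Couple each weight [X_i] with independent copies [Y_i], [Y'_i] by assumption
    A(q).  Talagrand's convex distance inequality shows that, with probability
    at least [1 - eps], some [G] within distance [r] of the family has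
    [Y_G <= L]: if [x] has a member [D] of weight at most [L] and no such [G]
    exists for [y], then [x] and [y] differ in more than [r] coordinates of
    [D], so the two events have product probability at most
    [exp (- r^2 / (4 ell)) <= eps^2].  By independence [G] has a patch of
    [Y']-weight at most [lam] with probability at least [1 - eps].  Hence
    [M <= L / (1-s)^(1/q) + lam / s^(1/q)], and [s] is optimized.  The lower
    tail follows by applying this bound to a quantile of [M] below the median.

    To stay within finite probability spaces the weights are rounded down to
    a truncated grid.  Rounding down only helps the two hypotheses, and in the
    conclusion it costs an arbitrarily small error, removed at the end by right
    continuity of the distribution function. *)

(** * Scalar inequalities *)

Section ScalarInequalities.
Variable R : realType.
Implicit Types x y t u theta : R.

Lemma expR_le_inv1B x : x < 1 -> expR x <= (1 - x)^-1.
Proof.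
move=> x1; rewrite -[x in expR x]opprK expRN lef_pV2 ?posrE ?expR_gt0 ?subr_gt0 //.
exact: expR_ge1Dx.
Qed.

(** The tangent line of the exponential at the mixed point [m] lies below the graph; averaging its
    values over [x] and [y] returns [expR m]. *)
Lemma expR_convex theta x y : 0 <= theta <= 1 ->
  expR (theta * x + (1 - theta) * y) <= theta * expR x + (1 - theta) * expR y.
Proof.
move=> /andP[t0 t1]; set m := theta * x + _.
have tangent z : expR m * (1 + (z - m)) <= expR z.
  have -> : expR z = expR m * expR (z - m) by rewrite -expRD addrC subrK.
  by rewrite ler_pM2l ?expR_gt0 ?expR_ge1Dx.
have hx := ler_wpM2l t0 (tangent x).
have hy : (1 - theta) * (expR m * (1 + (y - m))) <= (1 - theta) * expR y.
  by apply: ler_wpM2l; rewrite ?subr_ge0.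
apply: le_trans (lerD hx hy); rewrite le_eqVlt; apply/orP; left; apply/eqP.
by rewrite /m; ring.
Qed.

Lemma sqr_convex theta x y : 0 <= theta <= 1 ->
  (theta * x + (1 - theta) * y) ^+ 2 <= theta * x ^+ 2 + (1 - theta) * y ^+ 2.
Proof.
move=> /andP[t0 t1]; rewrite -subr_ge0.
have -> : theta * x ^+ 2 + (1 - theta) * y ^+ 2 - (theta * x + (1 - theta) * y) ^+ 2
  = theta * (1 - theta) * (x - y) ^+ 2 by ring.
by apply: mulr_ge0; [apply: mulr_ge0; rewrite ?subr_ge0|exact: sqr_ge0].
Qed.

(** With $u = e^{-t}$ this is $e^{-t^2} \le u(2-u)$, the scalar inequality behind Talagrand's
    induction at the optimal exponent. *)
Lemma sqr_1BexpRN_le t : 0 <= t <= 2^-1 ->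
  (1 - expR (- t)) ^+ 2 + expR (- t ^+ 2) <= 1.
Proof.
move=> /andP[t0 t12].
(* Squaring $1 - t/2 \le e^{-t/2}$ improves on the tangent line at 0. *)
have e1 : 1 - t + t ^+ 2 / 4 <= expR (- t).
  have -> : expR (- t) = expR (- t / 2) ^+ 2 by rewrite -expRM_natl; congr expR; field.
  have -> : 1 - t + t ^+ 2 / 4 = (1 + (- t / 2)) ^+ 2 by field.
  rewrite ler_sqr ?nnegrE ?expR_ge0 ?expR_ge1Dx //; lra.
have e2 : expR (- t) <= 1 by rewrite -expR0 ler_expR; lra.
have e3 : expR (- t ^+ 2) <= (1 + t ^+ 2)^-1.
  apply: le_trans (expR_le_inv1B _) _; first by have := sqr_ge0 t; lra.
  by rewrite opprK.
have e4 : (1 - expR (- t)) ^+ 2 <= (t - t ^+ 2 / 4) ^+ 2.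
  by rewrite ler_sqr ?nnegrE; nra.
apply: le_trans (lerD e4 e3) _.
have d0 : 0 < 1 + t ^+ 2 by have := sqr_ge0 t; lra.
rewrite -(ler_pM2r d0) mulrDl mulVf ?gt_eqF // mul1r.
(* What remains after dividing $(t - t^2/4)^2(1+t^2) \le t^2$ by $t^2$. *)
have key : (1 - t / 4) ^+ 2 * (1 + t ^+ 2) <= 1.
  have -> : (1 - t / 4) ^+ 2 * (1 + t ^+ 2) =
    1 - t * (2^-1 - t * (17 / 16) + t ^+ 2 / 2 - t ^+ 3 / 16) by field.
  rewrite gerBl mulr_ge0 //.
  have : t ^+ 3 / 16 <= t ^+ 2 / 32.
    have t2 : 0 <= 2^-1 - t by lra.
    have := mulr_ge0 (sqr_ge0 t) t2; rewrite [t ^+ 3]exprS; lra.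
  have := sqr_ge0 t; nra.
have := ler_wpM2l (sqr_ge0 t) key; nra.
Qed.

(* The optimal exponent is [theta = 1 + 2 ln u], truncated at [0]. *)
Lemma exists_mixing_exponent u : 0 < u <= 1 ->
  exists2 theta : R, 0 <= theta <= 1 &
    expR (- theta * ln u + (1 - theta) ^+ 2 / 4) <= 2 - u.
Proof.
move=> /andP[u0 u1]; have lnu0 : ln u <= 0 by apply: ln_le0.
have [lnu|lnu] := leP (- 2^-1) (ln u).
- exists (1 + 2 * ln u); first by apply/andP; split; lra.
  have [t ht] : exists t, ln u = - t by exists (- ln u); rewrite opprK.
  have /sqr_1BexpRN_le : 0 <= t <= 2^-1 by apply/andP; split; lra.
  rewrite -ht lnK ?posrE // => H.
  have -> : - (1 + 2 * ln u) * ln u + (1 - (1 + 2 * ln u)) ^+ 2 / 4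
    = - t ^+ 2 - ln u by rewrite ht; field.
  rewrite expRD [expR (- ln u)]expRN lnK ?posrE // ler_pdivrMr //; nra.
(* Here $u < e^{-1/2} \le 2/3$, so $2 - u \ge 4/3 \ge e^{1/4}$. *)
- exists 0; first by rewrite lexx ler01.
  have -> : - 0 * ln u + (1 - 0) ^+ 2 / 4 = 4^-1 by field.
  have : expR (4^-1 : R) <= 4 / 3.
    apply: le_trans (expR_le_inv1B _) _; first lra.
    by have -> : (1 - 4^-1)^-1 = 4 / 3 :> R by field.
  have : u <= 2 / 3.
    rewrite -[u]lnK ?posrE //; apply: le_trans (_ : expR (- 2^-1) <= _).
      by rewrite ler_expR ltW.
    apply: le_trans (expR_le_inv1B _) _; first lra.
    by have -> : (1 - - 2^-1)^-1 = 2 / 3 :> R by field.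
  lra.
Qed.

End ScalarInequalities.

Lemma big_option (A : Type) (idx : A) (op : Monoid.com_law idx) (S : finType)
    (f : option S -> A) :
  \big[op/idx]_o f o = op (f None) (\big[op/idx]_i f (Some i)).
Proof.
rewrite (bigD1 None) //=; congr (op _ _).
rewrite (reindex_omap Some id) /=; last by case.
by apply: eq_bigl => i; rewrite eqxx.
Qed.

(** * Finite product measures *)

Section ProductExpectation.
Variable R : realType.

Definition prodE (S V : finType) (p : V -> R) (f : {ffun S -> V} -> R) : R :=
  \sum_(x : {ffun S -> V}) (\prod_i p (x i)) * f x.

Definition prodP (S V : finType) (p : V -> R) (A : pred {ffun S -> V}) : R :=
  prodE p (fun x => (A x)%:R).

Definition is_law (V : finType) (p : V -> R) : Prop :=
  (forall v, 0 <= p v) /\ \sum_v p v = 1.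

Section Basics.
Variables (S V : finType) (p : V -> R).
Hypothesis p_law : is_law p.
Implicit Types (f g : {ffun S -> V} -> R) (A B : pred {ffun S -> V}).

Lemma prod_law_ge0 (x : {ffun S -> V}) : 0 <= \prod_i p (x i).
Proof. by apply: prodr_ge0 => i _; case: p_law. Qed.

(** Points with a coordinate of mass 0 have product weight 0. This form is needed since the coupling
    inequalities are known only on symbols of non-zero mass. *)
Lemma le_prodE_support f g :
    (forall x : {ffun S -> V}, (forall i, p (x i) != 0) -> f x <= g x) ->
  prodE p f <= prodE p g.
Proof.
move=> fg; apply: ler_sum => x _.
have [x0|] := eqVneq (\prod_i p (x i)) 0; first by rewrite x0 !mul0r.
move=> /prodf_neq0 xn0; apply: ler_wpM2l; first exact: prod_law_ge0.
by apply: fg => i; apply: xn0.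
Qed.

Lemma le_prodE f g : (forall x, f x <= g x) -> prodE p f <= prodE p g.
Proof. by move=> fg; apply: le_prodE_support => x _. Qed.

Lemma eq_prodE f g : f =1 g -> prodE p f = prodE p g.
Proof. by move=> fg; apply: eq_bigr => x _; rewrite fg. Qed.

Lemma prodE_cst c : prodE p (fun _ : {ffun S -> V} => c) = c.
Proof.
rewrite /prodE -mulr_suml -(bigA_distr_bigA (fun _ : S => p)) big1 ?mul1r //.
by move=> i _; case: p_law.
Qed.

Lemma prodED f g : prodE p (fun x => f x + g x) = prodE p f + prodE p g.
Proof. by rewrite -big_split; apply: eq_bigr => x _; rewrite mulrDr. Qed.

Lemma prodEZ c f : prodE p (fun x => c * f x) = c * prodE p f.
Proof. by rewrite mulr_sumr; apply: eq_bigr => x _; rewrite mulrCA. Qed.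

Lemma prodE_ge0 f : (forall x, 0 <= f x) -> 0 <= prodE p f.
Proof. by move=> f0; rewrite -[leLHS](prodE_cst 0); apply: le_prodE. Qed.

Lemma prodP_ge0 A : 0 <= prodP p A.
Proof. by apply: prodE_ge0 => x; rewrite ler0n. Qed.

Lemma le_prodP A B : (forall x, A x -> B x) -> prodP p A <= prodP p B.
Proof.
move=> AB; apply: le_prodE => x; rewrite ler_nat.
by case: (A x) (AB x) => // ->.
Qed.

Lemma prodPC A : prodP p (fun x => ~~ A x) = 1 - prodP p A.
Proof.
apply/eqP; rewrite eq_sym subr_eq -prodED -[X in X == _](prodE_cst 1).
by apply/eqP/eq_prodE => x; case: (A x); rewrite ?addr0 ?add0r.
Qed.

End Basics.

(** Induction on the number of coordinates uses [option S] as index type, the new coordinate sitting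
    at [None]. *)
Definition ffcons (S V : finType) (v : V) (x : {ffun S -> V}) : {ffun option S -> V} :=
  [ffun o => oapp x v o].

Lemma ffcons_bij (S V : finType) :
  bijective (fun vx : V * {ffun S -> V} => ffcons vx.1 vx.2).
Proof.
exists (fun z : {ffun option S -> V} => (z None, [ffun i => z (Some i)])).
- move=> [v x] /=; rewrite ffunE /=; congr pair.
  by apply/ffunP => i; rewrite !ffunE.
- by move=> z; apply/ffunP => -[i|]; rewrite !ffunE /= ?ffunE.
Qed.

Lemma big_ffcons (S V : finType) (f : {ffun option S -> V} -> R) :
  \sum_z f z = \sum_v \sum_x f (ffcons v x).
Proof. by rewrite (reindex _ (onW_bij _ (ffcons_bij S V))) pair_bigA. Qed.

Lemma prodE_option (S V : finType) (p : V -> R) (f : {ffun option S -> V} -> R) :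
  prodE p f = \sum_v p v * prodE p (fun x => f (ffcons v x)).
Proof.
rewrite /prodE big_ffcons; apply: eq_bigr => v _.
rewrite mulr_sumr; apply: eq_bigr => x _.
rewrite big_option /= !ffunE /= -mulrA; congr (_ * (_ * _)).
by apply: eq_bigr => i _; rewrite ffunE.
Qed.

Definition ffpull (S S' V : finType) (h : S -> S') (x : {ffun S' -> V}) : {ffun S -> V} :=
  [ffun i => x (h i)].

Lemma ffpull_bij (S S' V : finType) (h : S -> S') : bijective h ->
  bijective (@ffpull S S' V h).
Proof.
case=> g hg gh; exists (ffpull g) => x; apply/ffunP => i; rewrite !ffunE.
  by rewrite gh.
by rewrite hg.
Qed.

Lemma prodE_bij (S S' V : finType) (p : V -> R) (h : S -> S') f : bijective h ->
  prodE p f = prodE p (fun x : {ffun S' -> V} => f (ffpull h x)).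
Proof.
move=> hb; rewrite /prodE (reindex _ (onW_bij _ (ffpull_bij V hb))).
apply: eq_bigr => x _; congr (_ * _).
by rewrite [RHS](reindex _ (onW_bij _ hb)); apply: eq_bigr => i _; rewrite ffunE.
Qed.

(** Marginalization: the fibre over [x] is a product of coordinate fibres, so expanding the product
    of the sums [p (x i)] gives its mass. *)
Lemma prodE_map (S W V : finType) (j : W -> R) (p : V -> R) (g : W -> V)
    (f : {ffun S -> V} -> R) :
    (forall v, \sum_(c | g c == v) j c = p v) ->
  prodE j (fun z : {ffun S -> W} => f [ffun i => g (z i)]) = prodE p f.
Proof.
move=> jp; rewrite /prodE.
rewrite (partition_big (fun z : {ffun S -> W} => [ffun i => g (z i)]) xpredT) //=.
apply: eq_bigr => x _.
transitivity (\sum_(z : {ffun S -> W} | [ffun i => g (z i)] == x) (\prod_i j (z i)) * f x).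
  by apply: eq_bigr => z /eqP ->.
rewrite -mulr_suml; congr (_ * _).
under [RHS]eq_bigr do rewrite -jp.
rewrite bigA_distr_big_dep /=; apply: eq_bigl => z.
apply/eqP/familyP => [<- i|h]; first by rewrite unfold_in /= ffunE.
by apply/ffunP => i; rewrite ffunE; apply/eqP; have := h i; rewrite unfold_in.
Qed.

Lemma ffpair_bij (S V W : finType) :
  bijective (fun xy : {ffun S -> V} * {ffun S -> W} => [ffun i => (xy.1 i, xy.2 i)]).
Proof.
exists (fun z : {ffun S -> V * W} => ([ffun i => (z i).1], [ffun i => (z i).2])).
- by move=> [x y]; congr pair; apply/ffunP => i; rewrite !ffunE.
- by move=> z; apply/ffunP => i; rewrite !ffunE /=; case: (z i).
Qed.

(** Fubini's theorem for coordinates that are pairs of independent symbols. *)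
Lemma prodE_pair (S V W : finType) (p : V -> R) (p' : W -> R)
    (f : {ffun S -> V * W} -> R) :
  prodE (fun c => p c.1 * p' c.2) f =
  prodE p (fun x => prodE p' (fun y => f [ffun i => (x i, y i)])).
Proof.
rewrite /prodE (reindex _ (onW_bij _ (ffpair_bij S V W))) /=.
rewrite -(pair_bigA _ (fun (x : {ffun S -> V}) (y : {ffun S -> W}) =>
  (\prod_i (p ([ffun i => (x i, y i)] i).1 * p' ([ffun i => (x i, y i)] i).2)) *
  f [ffun i => (x i, y i)])) /=.
apply: eq_bigr => x _; rewrite mulr_sumr; apply: eq_bigr => y _.
rewrite big_split /= -mulrA; congr (_ * (_ * _));
by apply: eq_bigr => i _; rewrite ffunE.
Qed.

End ProductExpectation.

(** * Talagrand's convex distance inequality *)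

Section ConvexDistance.
Variables (R : realType) (V : finType) (p : V -> R).
Hypothesis p_law : is_law p.

(* [hull_dist2 B x c]: the squared convex distance from [x] to [B] is at most
   [c], the convex combination being the law [nu] of a random point of [B]. *)
Definition hull_dist2 (S : finType) (B : pred {ffun S -> V}) (x : {ffun S -> V})
    (c : R) : Prop :=
  exists nu : {ffun S -> V} -> R,
    [/\ is_law nu, (forall y, ~~ B y -> nu y = 0) &
        \sum_i (\sum_(y : {ffun S -> V} | y i != x i) nu y) ^+ 2 <= c].

Section Cons.
Variable S : finType.
Implicit Types (x y : {ffun S -> V}) (nu : {ffun S -> V} -> R).

Definition fftail (z : {ffun option S -> V}) : {ffun S -> V} :=
  [ffun i => z (Some i)].

Lemma ffconsK v x : fftail (ffcons v x) = x.
Proof. by apply/ffunP => i; rewrite !ffunE. Qed.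

Lemma ffcons_eta (z : {ffun option S -> V}) : ffcons (z None) (fftail z) = z.
Proof. by apply/ffunP => -[i|]; rewrite !ffunE /= ?ffunE. Qed.

(** The law of [ffcons (psi y) y] when [y] has law [nu]. *)
Definition push (psi : {ffun S -> V} -> V) nu (z : {ffun option S -> V}) : R :=
  if z None == psi (fftail z) then nu (fftail z) else 0.

Lemma sum_push psi nu (Q : pred {ffun option S -> V}) :
  \sum_(z | Q z) push psi nu z = \sum_(y | Q (ffcons (psi y) y)) nu y.
Proof.
rewrite big_mkcond big_ffcons exchange_big [RHS]big_mkcond /=.
apply: eq_bigr => y _; rewrite (bigD1 (psi y)) //= big1 ?addr0 => [|v vy].
  by rewrite /push ffconsK ffunE eqxx.
by rewrite /push ffconsK ffunE /= (negbTE vy) if_same.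
Qed.

(** Mix two laws: [nua] on the section of [B] at [v], and [nub] on the projection of [B], lifted to
    [B] by a choice of new coordinate. Old coordinates combine by convexity of the square; the new
    one differs from [v] only in the second part, with mass at most [1 - theta]. For [theta = 0] the
    law [nua] may be arbitrary, which covers an empty section. *)
Lemma hull_dist2_cons (B : pred {ffun option S -> V}) v x theta a b nua :
    0 <= theta <= 1 -> is_law nua ->
    (theta != 0 -> forall y, ~~ B (ffcons v y) -> nua y = 0) ->
    \sum_i (\sum_(y : {ffun S -> V} | y i != x i) nua y) ^+ 2 <= a ->
    hull_dist2 (fun y => [exists v', B (ffcons v' y)]) x b ->
  hull_dist2 B (ffcons v x) (theta * a + (1 - theta) * b + (1 - theta) ^+ 2).
Proof.
move=> t01 [nua0 nua1] nuaB nuac [nub [[nub0 nub1] nubB nubc]].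
have /andP[t0 t1] := t01.
have t1' : 0 <= 1 - theta by rewrite subr_ge0.
(* The default [v] is taken only outside the projection of [B], where [nub] vanishes. *)
pose psi y := odflt v [pick v' | B (ffcons v' y)].
pose nu z := theta * push (fun=> v) nua z + (1 - theta) * push psi nub z.
have sumnu (Q : pred {ffun option S -> V}) : \sum_(z | Q z) nu z =
    theta * (\sum_(y | Q (ffcons v y)) nua y) +
    (1 - theta) * (\sum_(y | Q (ffcons (psi y) y)) nub y).
  by rewrite big_split /= -!mulr_sumr !sum_push.
exists nu; split.
- split; last by rewrite sumnu nua1 nub1; ring.
  by move=> z; rewrite /nu /push addr_ge0 ?mulr_ge0 //; case: ifP.
- move=> z nBz; rewrite /nu /push.
  have -> : theta * (if z None == v then nua (fftail z) else 0) = 0.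
    have [->|t_neq0] := eqVneq theta 0; first by rewrite mul0r.
    case: eqP => zv; last by rewrite mulr0.
    by rewrite (nuaB t_neq0) ?mulr0 // -zv ffcons_eta.
  case: eqP => zp; last by rewrite mulr0 addr0.
  rewrite nubB ?mulr0 ?addr0 //; apply: contra nBz => /existsP[v' Bv'].
  move: zp; rewrite /psi; case: pickP => [w Bw /= zw|/(_ v')]; last by rewrite Bv'.
  by rewrite -(ffcons_eta z) zw.
- rewrite big_option /= addrC; apply: lerD.
    apply: le_trans (_ : theta * (\sum_i (\sum_(y : {ffun S -> V} | y i != x i) nua y) ^+ 2) +
       (1 - theta) * (\sum_i (\sum_(y : {ffun S -> V} | y i != x i) nub y) ^+ 2) <= _).
      rewrite !mulr_sumr -big_split /=; apply: ler_sum => i _.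
      apply: le_trans (sqr_convex _ _ t01); rewrite sumnu.
      have sumE nu' psi' :
          \sum_(y | ffcons (psi' y) y (Some i) != ffcons v x (Some i)) nu' y =
          \sum_(y : {ffun S -> V} | y i != x i) nu' y.
        by apply: eq_bigl => y; rewrite !ffunE.
      by rewrite (sumE nua (fun=> v)) (sumE nub psi).
    by apply: lerD; apply: ler_wpM2l.
  rewrite sumnu [X in theta * X]big1 ?mulr0 ?add0r; last first.
    by move=> y; rewrite !ffunE eqxx.
  rewrite ler_sqr ?nnegrE ?mulr_ge0 ?sumr_ge0 //.
  rewrite ler_piMr // -nub1 [leRHS](bigID (fun y => ffcons (psi y) y None != ffcons v x None)) /=.
  by rewrite lerDl sumr_ge0.
Qed.

End Cons.

(* Talagrand's convex distance inequality, with the squared distance replaced by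
   the certified upper bound [a]. *)
Definition convex_distance_ineq (S : finType) : Prop :=
  forall B : pred {ffun S -> V}, 0 < prodP p B ->
  exists2 a : {ffun S -> V} -> R, (forall x, hull_dist2 B x (a x)) &
    prodE p (fun x => expR (a x / 4)) <= (prodP p B)^-1.

(** There is a single point; having positive mass, [B] contains it, so the distance is 0. *)
Lemma convex_distance_void : convex_distance_ineq void.
Proof.
move=> B B0; exists (fun=> 0) => [x|].
  have Bx : B x.
    apply: contraTT B0 => nBx; rewrite -leNgt -[leRHS](prodE_cst void p_law 0).
    apply: le_prodE => // y; rewrite (_ : y = x) ?(negbTE nBx) //.
    by apply/ffunP; case.
  have eqx (y : {ffun void -> V}) : y = x by apply/ffunP; case.
  exists (fun=> 1); split; last by rewrite big_pred0 //; case.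
    split=> [y|]; first exact: ler01.
    by rewrite (bigD1 x) //= big_pred0 ?addr0 // => y; rewrite (eqx y) eqxx.
  by move=> y; rewrite (eqx y) Bx.
rewrite mul0r expR0 prodE_cst // invf_ge1 //.
rewrite -[leRHS](prodE_cst void p_law 1); apply: le_prodE => // x.
by rewrite lern1 leq_b1.
Qed.

(** Talagrand's induction step. For each value [v] of the new coordinate, the section [Bv v] and the
    projection [Bh] are mixed with the exponent of [exists_mixing_exponent]; the resulting bounds
    are linear in the mass of the section and are averaged over [v]. *)
Lemma convex_distance_option (S : finType) :
  convex_distance_ineq S -> convex_distance_ineq (option S).
Proof.
move=> IH B B0.
pose Bv v (x : {ffun S -> V}) := B (ffcons v x).
pose Bh (x : {ffun S -> V}) := [exists v, B (ffcons v x)].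
have PB : prodP p B = \sum_v p v * prodP p (Bv v) by rewrite /prodP prodE_option.
have Pv_le v : prodP p (Bv v) <= prodP p Bh.
  by apply: le_prodP => // x Bx; apply/existsP; exists v.
have P_le : prodP p B <= prodP p Bh.
  rewrite PB -[leRHS]mul1r -(proj2 p_law) mulr_suml; apply: ler_sum => v _.
  by apply: ler_wpM2l => //; case: p_law.
have Ph0 : 0 < prodP p Bh by apply: lt_le_trans P_le.
have [b hb Eb] := IH Bh Ph0.
suff /fin_all_exists[c hc] : forall v, exists c : {ffun S -> V} -> R,
    (forall x, hull_dist2 B (ffcons v x) (c x)) /\
    prodE p (fun x => expR (c x / 4)) <=
      (prodP p Bh)^-1 * (2 - prodP p (Bv v) / prodP p Bh).
  exists (fun z : {ffun option S -> V} => c (z None) (fftail z)) => [z|].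
    by rewrite -{1}(ffcons_eta z); have [] := hc (z None).
  rewrite prodE_option.
  apply: le_trans (_ : \sum_v p v * ((prodP p Bh)^-1 * (2 - prodP p (Bv v) / prodP p Bh)) <= _).
    apply: ler_sum => v _; apply: ler_wpM2l; first by case: p_law.
    have [_] := hc v; apply: le_trans; rewrite le_eqVlt; apply/orP; left; apply/eqP.
    by apply: eq_prodE => x; rewrite ffunE ffconsK.
  have -> : \sum_v p v * ((prodP p Bh)^-1 * (2 - prodP p (Bv v) / prodP p Bh)) =
      (prodP p Bh)^-1 * (2 - prodP p B / prodP p Bh).
    rewrite PB mulr_suml -[2 in RHS]mul1r -(proj2 p_law) mulr_suml -sumrB mulr_sumr.
    by apply: eq_bigr => v _; ring.
  rewrite -subr_ge0.
  (* This is $u(2-u) \le 1$ for $u = P(B)/P(Bh)$. *)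
  have -> : (prodP p B)^-1 - (prodP p Bh)^-1 * (2 - prodP p B / prodP p Bh)
      = (1 - prodP p B / prodP p Bh) ^+ 2 / prodP p B.
    by field; rewrite !gt_eqF.
  by rewrite divr_ge0 ?sqr_ge0 ?ltW.
move=> v.
have [Pv0|Pv0] := leP (prodP p (Bv v)) 0.
  have Pv : prodP p (Bv v) = 0 by apply/eqP; rewrite eq_le Pv0 prodP_ge0.
  (* For a null section only the projection is used, at cost 1 for the new coordinate; $e^{1/4} \le
     2$ suffices. *)
  exists (fun x => b x + 1); split=> [x|].
    have [nu [nul nuB nuc]] := hb x.
    have := @hull_dist2_cons S B v x 0 (b x) (b x) nu.
    rewrite mul0r subr0 add0r mul1r expr1n; apply=> //; first by rewrite lexx ler01.
    by rewrite eqxx.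
  rewrite Pv mul0r subr0.
  have -> : prodE p (fun x => expR ((b x + 1) / 4)) =
     expR 4^-1 * prodE p (fun x => expR (b x / 4)).
    by rewrite -prodEZ; apply: eq_prodE => x; rewrite -expRD; congr expR; ring.
  rewrite mulrC; apply: ler_pM => //; rewrite ?expR_ge0 //.
    by apply: prodE_ge0 => // x; rewrite expR_ge0.
  apply: le_trans (expR_le_inv1B _) _; first lra.
  have -> : (1 - 4^-1)^-1 = 4 / 3 :> R by field.
  lra.
have [a ha Ea] := IH (Bv v) Pv0.
have [|theta t01 ht] := @exists_mixing_exponent R (prodP p (Bv v) / prodP p Bh).
  by rewrite divr_gt0 //= ler_pdivrMr // mul1r.
have /andP[t0 t1] := t01.
exists (fun x => theta * a x + (1 - theta) * b x + (1 - theta) ^+ 2); split=> [x|].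
  have [nu [nul nuB nuc]] := ha x.
  exact: (@hull_dist2_cons S B v x theta (a x) (b x) nu).
set al := prodP p (Bv v) in Pv0 Ea ht *; set be := prodP p Bh in Ph0 Eb ht *.
(* Convexity of the exponential replaces Hölder's inequality: once $K =
   \alpha^{-\theta}\beta^{-(1-\theta)}e^{(1-\theta)^2/4}$ is factored out, the variables $\alpha
   e^{a/4}$ and $\beta e^{b/4}$ have expectation at most 1. *)
pose K := expR (- theta * ln al - (1 - theta) * ln be + (1 - theta) ^+ 2 / 4).
have KE : K = be^-1 * expR (- theta * ln (al / be) + (1 - theta) ^+ 2 / 4).
  rewrite -[X in X^-1 * _]lnK ?posrE // -expRN -expRD ln_div ?posrE //.
  by congr expR; ring.
apply: le_trans (_ : K <= _); last first.
  by rewrite KE; apply: ler_wpM2l => //; rewrite invr_ge0 ltW.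
apply: le_trans (_ : prodE p (fun x => K * (theta * al * expR (a x / 4) +
    (1 - theta) * be * expR (b x / 4))) <= _).
  apply: le_prodE => // x.
  have -> : expR ((theta * a x + (1 - theta) * b x + (1 - theta) ^+ 2) / 4) =
    K * expR (theta * (ln al + a x / 4) + (1 - theta) * (ln be + b x / 4)).
    by rewrite -expRD; congr expR; field.
  apply: ler_wpM2l; first exact: expR_ge0.
  apply: le_trans (expR_convex _ _ t01) _.
  by rewrite !expRD !lnK ?posrE // !mulrA.
rewrite prodEZ prodED !prodEZ ler_piMr ?expR_ge0 //.
have ha1 : al * prodE p (fun x => expR (a x / 4)) <= 1.
  by rewrite mulrC -ler_pdivlMr // mul1r.
have hb1 : be * prodE p (fun x => expR (b x / 4)) <= 1.
  by rewrite mulrC -ler_pdivlMr // mul1r.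
have := ler_wpM2l t0 ha1.
have t1' : 0 <= 1 - theta by lra.
have := ler_wpM2l t1' hb1.
rewrite !mulrA !mulr1; lra.
Qed.

Lemma convex_distance_bij (S S' : finType) (h : S -> S') : bijective h ->
  convex_distance_ineq S -> convex_distance_ineq S'.
Proof.
move=> hb IH B B0.
have [g hg gh] := hb.
have gb : bijective g by exists h.
have pullK (x : {ffun S' -> V}) : ffpull g (ffpull h x) = x.
  by apply/ffunP => i; rewrite !ffunE gh.
have PB : prodP p (fun x : {ffun S -> V} => B (ffpull g x)) = prodP p B.
  by rewrite /prodP (prodE_bij p _ gb).
have [|a ha Ea] := IH (fun x => B (ffpull g x)); first by rewrite PB.
exists (fun x => a (ffpull h x)) => [x|]; last first.
  by rewrite -(prodE_bij p (fun x => expR (a x / 4)) hb) -PB.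
have [nu [[nu0 nu1] nuB nuc]] := ha (ffpull h x).
exists (fun y => nu (ffpull h y)); split.
- split=> //; by rewrite -nu1 [RHS](reindex _ (onW_bij _ (ffpull_bij V hb))).
- by move=> y nBy; rewrite nuB // pullK.
- apply: le_trans nuc; rewrite (reindex _ (onW_bij _ hb)) /=.
  rewrite le_eqVlt; apply/orP; left; apply/eqP; apply: eq_bigr => i _.
  rewrite [in RHS](reindex _ (onW_bij _ (ffpull_bij V hb))) /=.
  by congr (_ ^+ 2); apply: eq_bigl => y; rewrite !ffunE.
Qed.

(** A model of the [n]-element set on which the induction on coordinates runs; a bijection then
    carries the inequality to [S]. *)
Fixpoint nary_option n : finType :=
  if n is m.+1 then option (nary_option m) else void.

Lemma card_nary_option n : #|nary_option n| = n.
Proof. by elim: n => [|n IH] /=; rewrite ?card_void ?card_option ?IH. Qed.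

Lemma convex_distance (S : finType) : convex_distance_ineq S.
Proof.
have [h hb] : exists h : nary_option #|S| -> S, bijective h.
  pose e := cast_ord (card_nary_option #|S|).
  exists (enum_val \o e \o enum_rank); apply: bij_comp (@enum_rank_bij _).
  apply: bij_comp (@enum_val_bij _) _.
  by exists (cast_ord (esym (card_nary_option #|S|))); [exact: cast_ordK|exact: cast_ordKV].
apply: (convex_distance_bij hb); elim: #|S| => [|n IH] /=.
  exact: convex_distance_void.
exact: convex_distance_option.
Qed.

(** Averaged over any law on [B], the number of differing coordinates in [D] is at least [r];
    Cauchy-Schwarz on [D] bounds the squared convex distance below by $r^2/l$, and the claim follows
    as in Markov's inequality. *)
Lemma convex_distance_certificate (S : finType) (A B : pred {ffun S -> V})
    (l : nat) (r : R) : 0 <= r ->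
    (forall x, A x -> exists2 D : {set S}, (#|D| <= l)%N &
       forall y, B y -> r <= #|[set i in D | y i != x i]%SET|%:R) ->
  prodP p A * prodP p B * expR (r ^+ 2 / l%:R / 4) <= 1.
Proof.
move=> r0 AB.
have [B0|B0] := leP (prodP p B) 0.
  have -> : prodP p B = 0 by apply/eqP; rewrite eq_le B0 prodP_ge0.
  by rewrite mulr0 mul0r ler01.
have [a ha Ea] := convex_distance B0.
rewrite mulrAC -ler_pdivlMr // mul1r; apply: le_trans Ea.
rewrite mulrC -prodEZ; apply: le_prodE => // x.
case Ax : (A x); last by rewrite mulr0 expR_ge0.
rewrite mulr1 ler_expR ler_wpM2r ?invr_ge0 //.
have [D Dl DB] := AB x Ax; have [nu [[nu0 nu1] nuB nuc]] := ha x.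
apply: le_trans nuc; set t := fun i => \sum_(y : {ffun S -> V} | y i != x i) nu y.
have rt : r <= \sum_(i in D) t i.
  have -> : \sum_(i in D) t i = \sum_y nu y * #|[set i in D | y i != x i]%SET|%:R.
    rewrite /t; under eq_bigr do rewrite big_mkcond.
    rewrite exchange_big /=; apply: eq_bigr => y _.
    rewrite -big_mkcondr /= sumr_const mulr_natr; congr (_ *+ _).
    by apply: eq_card => i; rewrite !inE.
  rewrite -[leLHS]mul1r -[X in X * r]nu1 mulr_suml; apply: ler_sum => y _.
  case By : (B y); last by rewrite nuB ?By // !mul0r.
  by apply: ler_wpM2l => //; apply: DB.
apply: le_trans (_ : \sum_(i in D) t i ^+ 2 <= _); last first.
  rewrite [leRHS](bigID (mem D)) /= lerDl; apply: sumr_ge0 => i _; exact: sqr_ge0.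
(* For [l = 0] the quotient [r ^+ 2 / l%:R] is 0 by convention. *)
have [->|l0] := posnP l.
  by rewrite invr0 mulr0; apply: sumr_ge0 => i _; exact: sqr_ge0.
have lR : 0 < l%:R :> R by rewrite ltr0n.
(* Cauchy-Schwarz in linearized form: [t^2 >= 2mt - m^2] with [m = r / l] *)
set m := r / l%:R; have m0 : 0 <= m by rewrite divr_ge0.
apply: le_trans (_ : \sum_(i in D) (2 * m * t i - m ^+ 2) <= _); last first.
  by apply: ler_sum => i _; have := sqr_ge0 (t i - m); nra.
rewrite sumrB -mulr_sumr sumr_const.
apply: le_trans (_ : 2 * m * r - m ^+ 2 * l%:R <= _).
  by rewrite /m le_eqVlt; apply/orP; left; apply/eqP; field; rewrite gt_eqF.
apply: lerB; first by rewrite ler_wpM2l // mulr_ge0.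
by rewrite -[leLHS]mulr_natr ler_wpM2l ?sqr_ge0 // ler_nat.
Qed.

End ConvexDistance.

(** * Patching in a finite product space *)

Lemma bigminn_le (I : finType) (A : pred I) (f : I -> nat) n i :
  A i -> (\big[minn/n]_(k | A k) f k <= f i)%N.
Proof.
move=> Ai; have : i \in index_enum I by rewrite mem_index_enum.
elim: (index_enum I) => // k s IH; rewrite inE big_cons => /predU1P[<-|/IH le_s].
  by rewrite Ai geq_minl.
by case: ifP => // _; apply: leq_trans (geq_minr _ _) le_s.
Qed.

Section FinitePatching.
Variables (R : realType) (S V : finType) (F : {set {set S}}).
Variables (p : V -> R) (phi : V -> R).
Hypothesis p_law : is_law p.
Hypothesis phi_ge0 : forall v, 0 <= phi v.
Implicit Types (x y z : {ffun S -> V}) (G D Q : {set S}).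

Definition fweight x G : R := \sum_(i in G) phi (x i).

Lemma fweight_subset x G D : G \subset D -> fweight x G <= fweight x D.
Proof.
move=> GD; rewrite /fweight [leRHS](big_setID G) /= (finset.setIidPr GD) lerDl.
exact: sumr_ge0.
Qed.

Lemma phi_le_fweight x G i : i \in G -> phi (x i) <= fweight x G.
Proof.
move=> iG; apply: le_trans (_ : fweight x [set i]%SET <= _).
  by rewrite /fweight big_set1.
by apply: fweight_subset; rewrite finset.sub1set.
Qed.

Definition meets (L : R) x : bool := [exists D in F, fweight x D <= L].

Definition almost_meets (r L : R) x : bool :=
  [exists G in patch_ball F r, fweight x G <= L].

(** Let [D] be light for [x] and [G] the part of [D] where [y] agrees with [x]. Then [G] is light
    for [y], and the disagreement set in [D] is a [G]-patch, so it has more than [r] elements unless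
    [G] lies in the ball. *)
Lemma far_from_meets r L x : meets L x ->
  exists2 D : {set S}, (#|D| <= ell F)%N &
    forall y, ~~ almost_meets r L y -> r < #|[set i in D | y i != x i]%SET|%:R.
Proof.
move=> /existsP[D /andP[DF xD]]; exists D.
  exact: (@leq_bigmax_cond _ (fun A => A \in F) (fun D : {set S} => #|D|) D DF).
move=> y; apply: contraNT; rewrite -leNgt => le_r.
pose G := [set i in D | y i == x i]%SET.
have GD : G \subset D by apply/fintype.subsetP => i; rewrite inE => /andP[].
apply/existsP; exists G; apply/andP; split; last first.
  apply: le_trans xD; apply: le_trans (fweight_subset x GD).
  rewrite le_eqVlt; apply/orP; left; apply/eqP; apply: eq_bigr => i.
  by rewrite inE => /andP[_ /eqP ->].
rewrite inE; apply: le_trans le_r; rewrite ler_nat.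
apply: bigminn_le; rewrite !inE /is_patch inE; apply/existsP; exists D; rewrite DF /=.
by apply/fintype.subsetP => i iD; rewrite !inE iD /= orbN.
Qed.

(** The size of [r] makes the exponential in the certificate bound at least $\varepsilon^{-2}$; as
    [meets] has probability at least $\varepsilon$, failure of [almost_meets] has probability at
    most $\varepsilon$. *)
Lemma almost_meets_likely eps r L : 0 < eps <= 1 ->
    eps <= prodP p (meets L) ->
    Num.sqrt (8 * ln eps^-1 * (ell F)%:R) <= r ->
  1 - eps <= prodP p (almost_meets r L).
Proof.
move=> /andP[e0 e1] eA ler.
have r0 : 0 <= r by apply: le_trans ler; exact: sqrtr_ge0.
have lne : 0 <= ln eps^-1 by apply: ln_ge0; rewrite invf_ge1.
suff : prodP p (fun x => ~~ almost_meets r L x) <= eps by rewrite prodPC //; lra.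
(* For [ell F = 0] the exponential bound is void, but the certificate [D] is then empty, which
   contradicts the strict inequality in [far_from_meets]. *)
have [l0|l0] := posnP (ell F).
  apply: le_trans (ltW e0); rewrite leNgt; apply/negP => Pgt0.
  have [x Ax] : exists x, meets L x.
    apply/existsP; apply: contraTT (lt_le_trans e0 eA) => /existsPn nA.
    rewrite -leNgt -[leRHS](prodE_cst S p_law 0); apply: le_prodE => // x.
    by rewrite (negbTE (nA x)).
  have [y By] : exists y, ~~ almost_meets r L y.
    apply/existsP; apply: contraTT Pgt0 => /existsPn nB.
    rewrite -leNgt -[leRHS](prodE_cst S p_law 0); apply: le_prodE => // y.
    by rewrite (negbTE (nB y)).
  have [D Dl /(_ y By)] := far_from_meets r Ax.
  rewrite ltNge => /negP; apply; apply: le_trans r0.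
  rewrite lern0 -leqn0; apply: leq_trans (_ : #|D| <= 0)%N; last by rewrite -l0.
  by apply: subset_leq_card; apply/fintype.subsetP => i; rewrite inE => /andP[].
have lR : 0 < (ell F)%:R :> R by rewrite ltr0n.
have AB : forall x, meets L x -> exists2 D : {set S}, (#|D| <= ell F)%N &
    forall y, ~~ almost_meets r L y -> r <= #|[set i in D | y i != x i]%SET|%:R.
  by move=> x /(far_from_meets r)[D Dl DB]; exists D => // y /DB /ltW.
have := convex_distance_certificate p_law r0 AB.
set PB := prodP p (fun x => ~~ almost_meets r L x).
have PB0 : 0 <= PB by apply: prodP_ge0.
have r2 : 8 * ln eps^-1 * (ell F)%:R <= r ^+ 2.
  have X0 : 0 <= 8 * ln eps^-1 * (ell F)%:R by rewrite mulr_ge0 ?mulr_ge0 // ltW.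
  by rewrite -(sqr_sqrtr X0) ler_sqr ?nnegrE ?sqrtr_ge0.
have eE : eps^-1 ^+ 2 <= expR (r ^+ 2 / (ell F)%:R / 4).
  have -> : eps^-1 ^+ 2 = expR (2%:R * ln eps^-1) by rewrite expRM_natl lnK // posrE invr_gt0.
  rewrite ler_expR ler_pdivlMr // ler_pdivlMr //; lra.
move=> H.
have H1 : eps * PB * eps^-1 ^+ 2 <= 1.
  apply: le_trans H; apply: ler_pM eE; rewrite ?sqr_ge0 ?mulr_ge0 ?(ltW e0) //.
  by rewrite ler_wpM2r.
have E : PB = eps * (eps * PB * eps^-1 ^+ 2) by field; rewrite gt_eqF.
by rewrite E ler_piMr // ltW.
Qed.

(** Here [j] is the joint law of one rounded coupled triple: its first entry has law [p], the other
    two are independent of law [p]. The error [h] and the conditions at [L] and [lam] reflect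
    rounding and truncation. The set [G] is found from the second entries alone, hence its patch is
    sought in independent weights. *)
Lemma meets_coupled (j : V * (V * V) -> R) (eps r L lam h a b : R) :
    (forall c, 0 <= j c) ->
    (forall v, \sum_(c | c.1 == v) j c = p v) ->
    (forall vw, \sum_(c | c.2 == vw) j c = p vw.1 * p vw.2) ->
    0 < a -> 0 < b -> 0 <= h ->
    (forall c, j c != 0 -> phi c.2.1 <= L -> phi c.1 <= (phi c.2.1 + h) / a) ->
    (forall c, j c != 0 -> phi c.2.2 <= lam -> phi c.1 <= (phi c.2.2 + h) / b) ->
    0 < eps <= 1 -> eps <= prodP p (meets L) ->
    Num.sqrt (8 * ln eps^-1 * (ell F)%:R) <= r ->
    (forall G, G \in patch_ball F r ->
       1 - eps <= prodP p (fun y => [exists Q in patches F G, fweight y Q <= lam])) ->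
  1 - 2 * eps <=
    prodP p (meets ((L + h * #|S|%:R) / a + (lam + h * #|S|%:R) / b)).
Proof.
move=> j0 j1 j2 a0 b0 h0 ja jb e01 eA ler patchG; have /andP[e0 e1] := e01.
set c := (_ / a + _).
pose both (xy : {ffun S -> V * V}) := [exists G in patch_ball F r,
  (fweight [ffun i => (xy i).1] G <= L) &&
  [exists Q in patches F G, fweight [ffun i => (xy i).2] Q <= lam]].
have j_law : is_law j.
  split=> //; rewrite -(proj2 p_law) (partition_big fst xpredT) //=.
  by apply: eq_bigr => v _; rewrite j1.
rewrite /prodP -(prodE_map _ j1).
apply: le_trans (_ : prodE j (fun z : {ffun S -> V * (V * V)} =>
    (both [ffun i => (z i).2])%:R) <= _); last first.
  apply: le_prodE_support => // z zsupp; rewrite ler_nat.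
  case: (boolP (both _)) => // /existsP[G /andP[_ /andP[GL /existsP[Q /andP[QP Ql]]]]].
  rewrite lt0n eqb0 negbK; move: QP; rewrite inE /is_patch inE => /existsP[D /andP[DF DGQ]].
  apply/existsP; exists D; rewrite DF /=.
  apply: le_trans (fweight_subset _ DGQ) _.
  set z1 := [ffun i => (z i).1].
  apply: le_trans (_ : fweight z1 G + fweight z1 Q <= _).
    rewrite /fweight (big_setID G) /= finset.setUK lerD2l finset.setDUl finset.setDv finset.set0U.
    by apply: fweight_subset; exact: finset.subsetDl.
  have cardle (H : {set S}) : h * #|H|%:R <= h * #|S|%:R.
    by rewrite ler_wpM2l // ler_nat max_card.
  apply: lerD.
    apply: le_trans (_ : \sum_(i in G) (phi (z i).2.1 + h) / a <= _).
      apply: ler_sum => i iG; rewrite ffunE; apply: ja => //.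
      apply: le_trans GL.
      by have := phi_le_fweight [ffun i => ([ffun i0 => (z i0).2] i).1] iG; rewrite !ffunE.
    rewrite -mulr_suml ler_wpM2r ?invr_ge0 ?(ltW a0) // big_split /= sumr_const.
    rewrite -[h *+ _]mulr_natr; apply: lerD => //; apply: le_trans GL.
    by rewrite /fweight le_eqVlt; apply/orP; left; apply/eqP; apply: eq_bigr => i _; rewrite !ffunE.
  apply: le_trans (_ : \sum_(i in Q) (phi (z i).2.2 + h) / b <= _).
    apply: ler_sum => i iG; rewrite ffunE; apply: jb => //.
    apply: le_trans Ql.
    by have := phi_le_fweight [ffun i => ([ffun i0 => (z i0).2] i).2] iG; rewrite !ffunE.
  rewrite -mulr_suml ler_wpM2r ?invr_ge0 ?(ltW b0) // big_split /= sumr_const.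
  rewrite -[h *+ _]mulr_natr; apply: lerD => //; apply: le_trans Ql.
  by rewrite /fweight le_eqVlt; apply/orP; left; apply/eqP; apply: eq_bigr => i _; rewrite !ffunE.
rewrite (prodE_map (fun xy => (both xy)%:R) j2) prodE_pair.
apply: le_trans (_ : prodE p (fun x => (1 - eps) * (almost_meets r L x)%:R) <= _).
  rewrite prodEZ.
  have := almost_meets_likely e01 eA ler; rewrite /prodP => H.
  have e1' : 0 <= 1 - eps by lra.
  (* Uses $(1-\varepsilon)^2 \ge 1 - 2\varepsilon$. *)
  by have := ler_wpM2l e1' H; have := sqr_ge0 eps; nra.
apply: le_prodE => // x.
case: (boolP (almost_meets r L x)) => [/existsP[G /andP[Gr GL]]|_]; last first.
  by rewrite mulr0; apply: prodE_ge0 => // y; rewrite ler0n.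
rewrite mulr1; apply: le_trans (patchG G Gr) _; apply: le_prodP => // y yQ.
have [e1y e2y] : [ffun i => ([ffun i0 => (x i0, y i0)] i).1] = x /\
    [ffun i => ([ffun i0 => (x i0, y i0)] i).2] = y.
  by split; apply/ffunP => i; rewrite !ffunE.
by apply/existsP; exists G; rewrite Gr e1y GL e2y.
Qed.

End FinitePatching.

(** * Discretization *)

Section Discretization.
Variables (R : realType) (h : R) (N : nat).
Hypothesis h_gt0 : 0 < h.

(** Index of the grid cell: rounding down in steps of [h], capped at [N] so that there are finitely
    many values. *)
Definition disc (x : R) : 'I_N.+1 := inord (minn (Num.truncn (x / h)) N).

Definition grid (v : 'I_N.+1) : R := h * v%:R.

Lemma grid_ge0 v : 0 <= grid v.
Proof. by rewrite mulr_ge0 ?ler0n // ltW. Qed.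

Lemma val_disc x : disc x = minn (Num.truncn (x / h)) N :> nat.
Proof. by rewrite inordK // ltnS geq_minr. Qed.

(** Stated with a bound [c >= 0] because negative values round to 0 and the coupled variables are
    non-negative only almost surely. *)
Lemma grid_disc_le x c : 0 <= c -> x <= c -> grid (disc x) <= c.
Proof.
move=> c0 xc; rewrite /grid val_disc mulrC -ler_pdivlMr //.
have c0' : 0 <= c / h by rewrite divr_ge0 // ltW.
apply: le_trans (_ : (Num.truncn (c / h))%:R <= _); last by rewrite truncn_le.
rewrite ler_nat; apply: leq_trans (geq_minl _ _) _; apply: le_truncn.
by rewrite ler_pM2r ?invr_gt0.
Qed.

Lemma le_grid_disc x : grid (disc x) < h * N%:R -> x <= grid (disc x) + h.
Proof.
rewrite /grid ltr_pM2l // ltr_nat val_disc gtn_min ltnn orbF => lt_N.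
rewrite (minn_idPl (ltnW lt_N)) -[X in _ + X]mulr1 -mulrDr natr1 mulrC -ler_pdivrMr //.
exact/ltW/truncnS_gt.
Qed.

Lemma le_disc x y : x <= y -> (disc x <= disc y)%N.
Proof.
move=> xy; rewrite !val_disc leq_min geq_minr andbT.
apply: leq_trans (geq_minl _ _) _; apply: le_truncn.
by rewrite ler_pM2r ?invr_gt0.
Qed.

(** Rounding is monotone, so its fibres are intervals. *)
Lemma measurable_disc v : measurable (disc @^-1` [set v]).
Proof.
apply: is_interval_measurable => x y /= <- yx z /andP[xz zy].
apply/val_inj/eqP; rewrite /= eqn_leq (le_disc xz) andbT -yx.
exact: le_disc.
Qed.

End Discretization.

(** * Laws of random variables with finitely many values *)

Section FiniteLaw.
Context (R : realType) (d : measure_display) (T : measurableType d).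
Variables (P : probability T R) (W : finType) (D : T -> W).
Hypothesis mD : forall c, measurable (D @^-1` [set c]).

Definition flaw (c : W) : R := fine (P (D @^-1` [set c])).

Lemma flawE c : (flaw c)%:E = P (D @^-1` [set c]).
Proof. by rewrite fineK // fin_num_measure. Qed.

Lemma flaw_ge0 c : 0 <= flaw c.
Proof. by rewrite -lee_fin flawE measure_ge0. Qed.

Lemma finite_event_seq (s : seq W) : uniq s ->
  measurable [set w | D w \in s] /\
  P [set w | D w \in s] = (\sum_(c <- s) flaw c)%:E.
Proof.
elim: s => [_|c s IH /= /andP[cs /IH[ms Ps]]].
  have -> : [set w | D w \in [::]] = set0 by apply/seteqP; split.
  by rewrite big_nil measure0.
have -> : [set w | D w \in c :: s] = D @^-1` [set c] `|` [set w | D w \in s].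
  apply/seteqP; split=> w /=; rewrite inE; first by case/predU1P; [left|right].
  by case=> [->|->]; rewrite ?eqxx ?orbT.
split; first exact: measurableU.
rewrite big_cons EFinD flawE -Ps measureU //.
by apply/seteqP; split=> w //= -[-> wc]; move: cs; rewrite wc.
Qed.

Lemma finite_event (Q : pred W) :
  measurable [set w | Q (D w)] /\
  P [set w | Q (D w)] = (\sum_(c | Q c) flaw c)%:E.
Proof.
have := finite_event_seq (enum_uniq Q); rewrite big_enum.
suff -> : [set w | D w \in enum Q] = [set w | Q (D w)] by [].
by apply/seteqP; split=> w /=; rewrite mem_enum.
Qed.

Lemma flaw_law : is_law flaw.
Proof.
split; first exact: flaw_ge0.
have [_] := finite_event xpredT.
have -> : [set w | xpredT (D w)] = setT by apply/seteqP; split.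
by rewrite probability_setT => -[].
Qed.

(** Carries inequalities that hold surely over to the atoms of the finite law. *)
Lemma flaw_neq0 c : flaw c != 0 -> exists w, D w = c.
Proof.
apply: contra_neqP => nw; rewrite /flaw (_ : _ @^-1` _ = set0) ?measure0 //.
by apply/seteqP; split=> w //= wc; apply: nw; exists w.
Qed.

End FiniteLaw.

(** * Minima of weights over families of sets *)

Lemma min_over_le (R : realType) (I : finType) (A : {set I}) (f : I -> R) c :
  A != finset.set0 -> (min_over A f <= c) = [exists i in A, f i <= c].
Proof.
move=> /set0Pn[i0 iA]; rewrite /min_over; case: pickP => [k kA|/(_ i0)]; last first.
  by rewrite iA.
apply/bigmin_leP/existsP => [[fk|[i /= iA' fi]]|[i /andP[iA' fi]]].
- by exists k; rewrite kA.
- by exists i; rewrite iA'.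
- by right; exists i.
Qed.

Lemma patches_neq0 (S : finType) (F : {set {set S}}) G :
  F != finset.set0 -> patches F G != finset.set0.
Proof.
move=> /set0Pn[D DF]; apply/set0Pn; exists D; rewrite inE /is_patch inE.
by apply/existsP; exists D; rewrite DF finset.subsetUr.
Qed.

Section Weights.
Context (R : realType) (d : measure_display) (T : measurableType d).
Variables (P : probability T R) (S : finType) (X : S -> {RV P >-> R}).

Lemma measurable_weight G : measurable_fun setT (weight X G).
Proof.
rewrite /weight (_ : (fun _ => _) = fun w => \sum_(i <- enum G) X i w).
  by apply: measurable_sum => i; exact: measurable_funPT.
by apply/funext => w; rewrite big_enum.
Qed.

Lemma measurable_min_over (A : {set {set S}}) :
  measurable_fun setT (fun w => min_over A (fun D => weight X D w)).
Proof.
rewrite /min_over; case: pickP => [D0 _|_]; last exact: measurable_cst.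
elim: (index_enum _) => [|D s IH].
  by under eq_fun do rewrite big_nil; exact: measurable_weight.
under eq_fun do rewrite big_cons.
by case: (D \in A) => //; apply: measurable_minr => //; exact: measurable_weight.
Qed.

Lemma measurable_min_over_in (A : {set {set S}}) (B : set R) : measurable B ->
  measurable [set w | B (min_over A (fun D => weight X D w))].
Proof.
by move=> mB; rewrite -[X in measurable X]setTI; exact: measurable_min_over.
Qed.

Lemma measurable_min_over_le (A : {set {set S}}) (c : R) :
  measurable [set w | min_over A (fun D => weight X D w) <= c].
Proof.
have := measurable_min_over_in A (measurable_itv `]-oo, c]).
by under eq_set do rewrite /= in_itv.
Qed.

(** Right continuity of the distribution function: the events [E n] decrease to the event at level
    [c]. *)
Lemma min_over_le_right_cont (A : {set {set S}}) (c e : R) :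
    (forall b : R, c < b -> (e%:E <= P [set w | (min_over A (fun D => weight X D w) <= b)%R])%E) ->
  (e%:E <= P [set w | (min_over A (fun D => weight X D w) <= c)%R])%E.
Proof.
move=> H; pose E n := [set w | min_over A (fun D => weight X D w) <= c + n.+1%:R^-1].
have -> : [set w | min_over A (fun D => weight X D w) <= c] = \bigcap_n E n.
  apply/seteqP; split=> w /=.
    by move=> wc n _; apply: le_trans wc _; rewrite lerDl invr_ge0 ler0n.
  move=> wE; apply/ler_addgt0Pr => b b0.
  have [n nb] : exists n, n.+1%:R^-1 <= b.
    exists (Num.truncn b^-1); rewrite -[leRHS]invrK lef_pV2 ?posrE ?invr_gt0 ?ltr0n //.
    exact/ltW/truncnS_gt.
  by apply: le_trans (wE n I) _; rewrite lerD2l.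
have mE n : measurable (E n) by exact: measurable_min_over_le.
have cvgE : P (E n) @[n --> \oo] --> P (\bigcap_n E n).
  apply: nonincreasing_cvg_mu => [| | |m n mn] //.
  - by rewrite -ge0_fin_numE// fin_num_measure.
  - by apply: bigcap_measurable.
  - apply/subsetPset => w /= /le_trans; apply.
    by rewrite lerD2l lef_pV2 ?posrE ?ltr0n // ler_nat.
rewrite -(cvg_lim _ cvgE) //; apply: lime_ge; first by apply/cvg_ex; exists (P (\bigcap_n E n)).
by apply: nearW => n; apply: H; rewrite ltrDl invr_gt0 ltr0n.
Qed.

End Weights.

(** * The bound for a fixed splitting parameter *)

Section DiscretizedWeights.
Context (R : realType) (d : measure_display) (T : measurableType d).
Variables (P : probability T R) (S : finType) (X : S -> {RV P >-> R}).
Variables (h : R) (N : nat) (i0 : S).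
Hypothesis h_gt0 : 0 < h.
Hypothesis X_indep : mutually_independent X.
Hypothesis X_same : forall i j, same_law (X i) (X j).
Hypothesis X_ge0 : forall i w, 0 <= X i w.

Local Notation V := 'I_N.+1.

(** The weights share one law, so the reference index [i0] serves every coordinate. *)
Definition disc_law : V -> R := flaw P (fun w => disc h N (X i0 w)).

Definition dvec (w : T) : {ffun S -> V} := [ffun i => disc h N (X i w)].

Lemma measurable_disc_RV (d' : measure_display) (T' : measurableType d')
    (Q : probability T' R) (Z : {RV Q >-> R}) v :
  measurable ((fun w => disc h N (Z w)) @^-1` [set v]).
Proof.
exact: (measurable_funPTI Z (measurable_disc h_gt0 v)).
Qed.

Lemma disc_law_same (d' : measure_display) (T' : measurableType d')
    (Q : probability T' R) (Z : {RV Q >-> R}) v : same_law Z (X i0) ->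
  Q ((fun w => disc h N (Z w)) @^-1` [set v]) = (disc_law v)%:E.
Proof.
move=> ZX; rewrite flawE; last exact: measurable_disc_RV.
exact: (ZX _ (measurable_disc h_gt0 v)).
Qed.

Lemma disc_law_law : is_law disc_law.
Proof. by apply: flaw_law => v; exact: measurable_disc_RV. Qed.

Lemma dvec_preimage x : dvec @^-1` [set x] =
  \bigcap_(i in [set` [set: S]%SET]) (X i @^-1` (disc h N @^-1` [set x i])).
Proof.
apply/seteqP; split=> w /=; first by move=> <- i _ /=; rewrite ffunE.
move=> wx; apply/ffunP => i; rewrite ffunE.
by apply: wx; rewrite /= inE.
Qed.

Lemma measurable_dvec x : measurable (dvec @^-1` [set x]).
Proof.
rewrite dvec_preimage; apply: fin_bigcap_measurable; first exact: finite_finset.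
by move=> i _; exact: measurable_disc_RV.
Qed.

Lemma dvec_flaw x : flaw P dvec x = \prod_i disc_law (x i).
Proof.
have := flawE P measurable_dvec x.
rewrite dvec_preimage X_indep; last by move=> i; exact: measurable_disc.
rewrite (eq_bigr (fun i => (disc_law (x i))%:E)); last first.
  by move=> i _; exact: (disc_law_same (x i) (X_same i i0)).
rewrite prodEFin => -[->]; by apply: eq_bigl => i; rewrite inE.
Qed.

Lemma dvec_event (Q : pred {ffun S -> V}) :
  measurable [set w | Q (dvec w)] /\ P [set w | Q (dvec w)] = (prodP disc_law Q)%:E.
Proof.
have [mQ PQ] := finite_event P measurable_dvec Q; split=> //.
rewrite PQ big_mkcond; congr (_%:E); apply: eq_bigr => x _; rewrite dvec_flaw.
by case: (Q x); rewrite ?mulr1 ?mulr0.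
Qed.

Lemma fweight_dvec_le G w : fweight (grid h (N:=N)) (dvec w) G <= weight X G w.
Proof. by apply: ler_sum => i _; rewrite ffunE; apply: grid_disc_le. Qed.

(** Rounding down only lowers weights, so lower bounds on such probabilities survive
    discretization. *)
Lemma dvec_prob_ge (A : {set {set S}}) (c e : R) : A != finset.set0 ->
    (e%:E <= P [set w | (min_over A (fun D => weight X D w) <= c)%R])%E ->
  e <= prodP disc_law (fun x => [exists D in A, fweight (grid h (N:=N)) x D <= c]).
Proof.
move=> A0 eP; set Q : pred {ffun S -> V} := fun x => _.
have [mQ PQ] := dvec_event Q; rewrite -lee_fin -PQ.
apply: le_trans eP _; apply: le_measure; rewrite ?inE //.
  exact: measurable_min_over_le.
move=> w /=; rewrite min_over_le // => /existsP[D /andP[DA wD]].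
by apply/existsP; exists D; rewrite DA (le_trans (fweight_dvec_le _ _)).
Qed.

(** Below the cap each of at most [#|S|] coordinates loses at most [h]. *)
Lemma weight_le_fweight_dvec G w c : fweight (grid h (N:=N)) (dvec w) G <= c ->
  c < h * N%:R -> weight X G w <= c + h * #|S|%:R.
Proof.
move=> Gc cN; apply: le_trans (_ : \sum_(i in G) (grid h (dvec w i) + h) <= _).
  apply: ler_sum => i iG; rewrite ffunE; apply: le_grid_disc => //.
  apply: le_lt_trans cN; apply: le_trans Gc.
  have := phi_le_fweight (grid_ge0 (N:=N) h_gt0) (dvec w) iG; by rewrite ffunE.
rewrite big_split /= sumr_const -[h *+ _]mulr_natr; apply: lerD => //.
by rewrite ler_wpM2l ?(ltW h_gt0) // ler_nat max_card.
Qed.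

End DiscretizedWeights.

(** * Transfer of the finite bound to the original weights *)

Section CoupledBound.
Context (R : realType) (d : measure_display) (T : measurableType d).
Variables (P : probability T R) (S : finType) (X : S -> {RV P >-> R}) (q : R).
Variables (F : {set {set S}}) (eps L r lam : R).
Hypothesis F_neq0 : F != finset.set0.
Hypothesis X_iid : iid_weights q X.
Hypothesis eps_gt0 : 0 < eps.
Hypothesis F_likely : (eps%:E <= P [set w | (min_weight X F w <= L)%R])%E.
Hypothesis r_large : Num.sqrt (8 * ln eps^-1 * (ell F)%:R) <= r.
Hypothesis lam_gt0 : 0 < lam.
Hypothesis F_patchable : family_patchable X F r lam eps.

Lemma likely_prob_le1 : eps <= 1.
Proof.
rewrite -lee_fin; apply: le_trans F_likely _; apply: probability_le1.
exact: measurable_min_over_le.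
Qed.

Lemma likely_bound_ge0 : 0 <= L.
Proof.
rewrite leNgt; apply/negP => L0; move: F_likely.
rewrite (_ : [set w | _] = set0) ?measure0 ?lee_fin ?leNgt ?eps_gt0 //.
apply/seteqP; split=> w //=; rewrite /min_weight min_over_le // => /existsP[D /andP[_]].
move=> /le_lt_trans /(_ L0); rewrite ltNge => /negP; apply.
by apply: sumr_ge0 => i _; case: X_iid.
Qed.

Lemma min_weight_coupled_slack (i0 : S) s delta : 0 < s < 1 -> 0 < delta ->
  ((1 - 2 * eps)%:E <= P [set w | (min_weight X F w <=
     L / (1 - s) `^ q^-1 + lam / s `^ q^-1 + delta)%R])%E.
Proof.
move=> /andP[s0 s1] delta0; have [X_indep X_same X_ge0 XA] := X_iid.
have s01 : 0 < s < 1 by rewrite s0.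
set a := (1 - s) `^ q^-1; set b := s `^ q^-1.
have a0 : 0 < a by rewrite powR_gt0 // subr_gt0.
have b0 : 0 < b by rewrite powR_gt0.
have L0 := likely_bound_ge0; set n : R := #|S|%:R.
have n0 : 0 <= n by rewrite ler0n.
(* Three rounding losses of size [h * n]: in [Y], divided by [a]; in [Y'], divided by [b]; and on
   returning from the grid to [X]. *)
pose k := a^-1 + b^-1 + 1.
have k0 : 0 < k by rewrite !addr_gt0 ?invr_gt0.
pose h := delta / ((n + 1) * k).
have h0 : 0 < h by rewrite divr_gt0 // mulr_gt0 //; lra.
have hk : h * n * k <= delta.
  have -> : h * n * k = delta * (n / (n + 1)).
    by rewrite /h; field; rewrite !gt_eqF //=; lra.
  by rewrite ler_piMr ?(ltW delta0) // ler_pdivrMr; lra.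
pose c := (L + h * n) / a + (lam + h * n) / b.
have hn0 : 0 <= h * n by rewrite mulr_ge0 // ltW.
have c0 : 0 <= c.
  by apply: addr_ge0; apply: divr_ge0; rewrite ?(ltW a0) ?(ltW b0) // addr_ge0 // ltW.
(* The cap [h * N] exceeds [L], [lam] and [c], so truncation never affects the events compared. *)
pose N := (Num.truncn ((L + lam + c) / h)).+1.
have hN : L + lam + c < h * N%:R by rewrite mulrC -ltr_pdivrMr //; exact: truncnS_gt.
have [LN lamN cN] : [/\ L < h * N%:R, lam < h * N%:R & c < h * N%:R].
  have lam0 := ltW lam_gt0; split; apply: le_lt_trans hN.
  - by rewrite -addrA lerDl addr_ge0.
  - by rewrite addrAC lerDr addr_ge0.
  - by rewrite lerDr addr_ge0.
have [d' [T' [Q [Z [Y [Y' [ZX YX YX' indYY' ZY]]]]]]] := XA i0 s s01.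
have [] := @dvec_event _ _ _ _ _ X h N i0 h0 X_indep X_same
  (meets F (grid h (N:=N)) c).
set p := @disc_law _ _ _ _ _ _ _ _ _ => mc Pc.
pose tr w := (disc h N (Z w), (disc h N (Y w), disc h N (Y' w))).
have trE u : tr @^-1` [set u] = (fun w => disc h N (Z w)) @^-1` [set u.1] `&`
    ((fun w => disc h N (Y w)) @^-1` [set u.2.1] `&` (fun w => disc h N (Y' w)) @^-1` [set u.2.2]).
  case: u => [u1 [u2 u3]]; apply/seteqP; split=> w /=.
    by case=> <- <- <-.
  by case=> <- [<- <-].
have mtr u : measurable (tr @^-1` [set u]).
  by rewrite trE; do 2?[apply: measurableI]; exact: measurable_disc_RV.
have key : 1 - 2 * eps <= prodP p (meets F (grid h (N:=N)) c).
  apply: (@meets_coupled _ _ _ _ p (grid h (N:=N)) _ _ (flaw Q tr) eps r L lam h a b) => //.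
  - exact: disc_law_law.
  - exact: grid_ge0.
  - exact: flaw_ge0.
  - move=> v; have [_ Qv] := finite_event Q mtr (fun u => u.1 == v).
    apply: EFin_inj; rewrite -Qv -(disc_law_same h0 v ZX); congr (Q _).
    by apply/seteqP; split=> w /= /eqP.
  - move=> [v v']; have [_ Qv] := finite_event Q mtr (fun u => u.2 == (v, v')).
    apply: EFin_inj; rewrite -Qv EFinM -(disc_law_same h0 v YX) -(disc_law_same h0 v' YX').
    rewrite -(indYY' _ _ (measurable_disc h0 v) (measurable_disc h0 v')); congr (Q _).
    by apply/seteqP; split=> w /=; [case/eqP=> <- <- | case=> <- <-].
  - exact: ltW.
  - move=> u /flaw_neq0[w <-] /= YL; apply: grid_disc_le => //.
      by rewrite divr_ge0 ?addr_ge0 ?grid_ge0 ?(ltW h0) ?(ltW a0).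
    apply: le_trans (ZY w) _; rewrite ge_min ler_pM2r ?invr_gt0 //.
    by rewrite le_grid_disc // (le_lt_trans YL).
  - move=> u /flaw_neq0[w <-] /= YL; apply: grid_disc_le => //.
      by rewrite divr_ge0 ?addr_ge0 ?grid_ge0 ?(ltW h0) ?(ltW b0).
    apply: le_trans (ZY w) _; rewrite ge_min [X in _ || X]ler_pM2r ?invr_gt0 //.
    by rewrite [X in _ || X]le_grid_disc ?orbT // (le_lt_trans YL).
  - by rewrite eps_gt0 likely_prob_le1.
  - exact: dvec_prob_ge.
  - by move=> G /F_patchable; apply: dvec_prob_ge => //; exact: patches_neq0.
apply: le_trans (_ : ((1 - 2 * eps)%:E <= (prodP p (meets F (grid h (N:=N)) c))%:E)%E) _ => //.
rewrite -Pc; apply: le_measure; rewrite ?inE //; first exact: measurable_min_over_le.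
move=> w /= /existsP[D /andP[DF wD]].
rewrite /min_weight min_over_le //; apply/existsP; exists D; rewrite DF /=.
apply: le_trans (weight_le_fweight_dvec h0 wD cN) _.
rewrite -/n; have -> : c + h * n = L / a + lam / b + h * n * k by rewrite /c /k; ring.
by rewrite lerD2l.
Qed.

Lemma min_weight_coupled s : 0 < s < 1 ->
  ((1 - 2 * eps)%:E <= P [set w | (min_weight X F w <=
     L / (1 - s) `^ q^-1 + lam / s `^ q^-1)%R])%E.
Proof.
move=> s01; have /andP[s0 s1] := s01; case: (pickP (@predT S)) => [i0 _|S0].
  apply: min_over_le_right_cont => // b; rewrite -subr_gt0 => b0.
  by have := min_weight_coupled_slack i0 s01 b0; rewrite subrKC.
(* Without an index in [S] every weight is an empty sum, and the bound is non-negative. *)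
have -> : [set w | min_weight X F w <= L / (1 - s) `^ q^-1 + lam / s `^ q^-1] = setT.
  apply/seteqP; split=> w //= _; rewrite /min_weight min_over_le //.
  have /set0Pn[D DF] := F_neq0; apply/existsP; exists D; rewrite DF /=.
  rewrite /weight big1 => [|i]; last by have := S0 i.
  by rewrite addr_ge0 // divr_ge0 ?powR_ge0 ?likely_bound_ge0 ?(ltW lam_gt0).
by rewrite probability_setT lee_fin; have := eps_gt0; lra.
Qed.

End CoupledBound.

(** * Optimization and deviations from the median *)

Section Powers.
Variable R : realType.
Implicit Types x y : R.

(** By convexity the power lies below its chord on $[0,1]$, with end values $1$ and $2^n$. *)
Lemma exprDn_le_chord x n : 0 <= x <= 1 -> (1 + x) ^+ n <= 1 + (2 ^+ n - 1) * x.
Proof.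
move=> /andP[x0 x1]; elim: n => [|n IH]; first by rewrite !expr0 subrr mul0r addr0.
have x0' : 0 <= 1 + x by lra.
rewrite exprS; apply: le_trans (ler_wpM2l x0' IH) _; rewrite [2 ^+ n.+1]exprS.
have : 1 <= 2 ^+ n :> R by rewrite exprn_ege1 // ler1n.
move: (2 ^+ n) => c c1.
have : 0 <= (c - 1) * (x * (1 - x)) by rewrite !mulr_ge0 //; lra.
nra.
Qed.

Lemma bernoulli_ineq x n : 0 <= x <= 1 -> 1 - n%:R * x <= (1 - x) ^+ n.
Proof.
move=> /andP[x0 x1]; elim: n => [|n IH]; first by rewrite expr0 mul0r subr0.
have x1' : 0 <= 1 - x by lra.
rewrite exprS; apply: le_trans _ (ler_wpM2l x1' IH); rewrite -natr1.
have : 0 <= n%:R * (x * x) by rewrite !mulr_ge0.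
nra.
Qed.

Lemma powR_1 x : 1 `^ x = 1.
Proof. by rewrite powR1. Qed.

Variable q : R.
Hypothesis q_gt0 : 0 < q.

Local Notation a := (q / (q + 1)).
Local Notation b := ((q + 1) / q).

Lemma exponent_gt0 : 0 < a.
Proof. by rewrite divr_gt0 ?addr_gt0. Qed.

Lemma exponentV_gt0 : 0 < b.
Proof. by rewrite divr_gt0 ?addr_gt0. Qed.

Lemma powR_exponentK x : 0 <= x -> (x `^ a) `^ b = x.
Proof.
move=> x0; rewrite -powRrM (_ : a * b = 1) ?powRr1 //.
by field; rewrite !gt_eqF ?addr_gt0.
Qed.

Lemma powR_exponentVK x : 0 <= x -> (x `^ b) `^ a = x.
Proof. by move=> x0; rewrite powRAC powR_exponentK. Qed.

(** Rests on the exponent identity $a + a/q = 1$. *)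
Lemma optimal_split_term x y : 0 < x -> 0 < y ->
  x / (x `^ a / y) `^ q^-1 = x `^ a * y `^ q^-1.
Proof.
move=> x0 y0; have xa0 : 0 < x `^ a by rewrite powR_gt0.
have xy0 : 0 < x `^ a / y by rewrite divr_gt0.
suff {1}-> : x = x `^ a * y `^ q^-1 * (x `^ a / y) `^ q^-1.
  by rewrite mulfK // gt_eqF // powR_gt0.
rewrite -mulrA -powRM ?ltW // mulrCA divff ?gt_eqF // mulr1 -powRrM -powRD.
  by rewrite (_ : _ + _ = 1) ?powRr1 ?ltW //; field; rewrite !gt_eqF ?addr_gt0.
by rewrite (gt_eqF x0) implybT.
Qed.

(** The given [s] is where the derivative of the left-hand side in [s] vanishes; both terms then
    share the factor $(x^a+y^a)^{1/q}$, and $1 + 1/q = b$. *)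
Lemma optimal_split x y : 0 < x -> 0 < y ->
  let s := y `^ a / (x `^ a + y `^ a) in
  x / (1 - s) `^ q^-1 + y / s `^ q^-1 = (x `^ a + y `^ a) `^ b.
Proof.
move=> x0 y0 s; have xa0 : 0 < x `^ a by rewrite powR_gt0.
have ya0 : 0 < y `^ a by rewrite powR_gt0.
have D0 : 0 < x `^ a + y `^ a by rewrite addr_gt0.
have -> : 1 - s = x `^ a / (x `^ a + y `^ a).
  by rewrite /s; field; rewrite gt_eqF.
rewrite !optimal_split_term // -mulrDl -{1}[x `^ a + y `^ a]powRr1 ?ltW // -powRD.
  by congr (_ `^ _); field; rewrite gt_eqF.
by rewrite (gt_eqF D0) implybT.
Qed.

Lemma split_factor m x : 0 < m -> 0 < x ->
  m `^ a + x `^ a = m `^ a * (1 + (x / m) `^ a).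
Proof.
move=> m0 x0; rewrite mulrDr mulr1 -powRM ?divr_ge0 ?(ltW m0) ?(ltW x0) //.
by rewrite mulrCA divff ?gt_eqF // mulr1.
Qed.

Lemma powR_exponent_mulK m y : 0 <= m -> 0 <= y -> (m `^ a * y) `^ b = m * y `^ b.
Proof. by move=> m0 y0; rewrite powRM ?powR_ge0 // powR_exponentK. Qed.

Definition deviation_degree : nat := (Num.truncn b).+1.

(** With [n] the degree, $2^n$ dominates both the chord slope $2^n - 1$ of the upper deviation and
    the Bernoulli slope $n$ of the lower one. *)
Definition deviation_constant : R := 2 ^+ deviation_degree.

Lemma exponentV_le_degree : b <= deviation_degree%:R.
Proof. exact/ltW/truncnS_gt. Qed.

Lemma deviation_constant_ge2 : 2 <= deviation_constant.
Proof.
rewrite /deviation_constant /deviation_degree exprS -[leLHS]mulr1 ler_pM2l //.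
by rewrite exprn_ege1 // ler1n.
Qed.

Lemma upper_deviation x : 0 <= x <= 1 ->
  (1 + x) `^ b <= 1 + deviation_constant * x.
Proof.
move=> x01; have /andP[x0 x1] := x01.
apply: le_trans (_ : (1 + x) ^+ deviation_degree <= _).
  rewrite -powR_mulrn; last by lra.
  by apply: ler_powR; [lra|exact: exponentV_le_degree].
apply: le_trans (exprDn_le_chord _ x01) _.
by rewrite -/deviation_constant; nra.
Qed.

(** After raising to the power [b]: $(1-x)^b \ge (1-x)^n \ge 1 - nx > 1 - Cx$ by Bernoulli.
    Strictness later makes two events disjoint. *)
Lemma lower_deviation x : 0 < x -> deviation_constant * x <= 1 ->
  (1 - deviation_constant * x) `^ a < 1 - x.
Proof.
move=> x0 Cx; have C2 := deviation_constant_ge2.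
have x1 : x < 1 by nra.
have x01 : 0 <= x <= 1 by rewrite !ltW.
have y0 : 0 <= 1 - x by lra.
rewrite -[ltRHS]powR_exponentVK //.
apply: gt0_ltr_powR; rewrite ?nnegrE ?powR_ge0 ?subr_ge0 //; first exact: exponent_gt0.
apply: lt_le_trans (_ : (1 - x) ^+ deviation_degree <= _); last first.
  rewrite -powR_mulrn //; apply: ger_powR; last exact: exponentV_le_degree.
  by apply/andP; split; lra.
apply: lt_le_trans (bernoulli_ineq _ x01).
rewrite ltrD2l ltrN2 ltr_pM2r // /deviation_constant -natrX ltr_nat.
exact: ltn_expl.
Qed.

End Powers.

(** * Tail bounds for the minimum weight *)

Section Tails.
Context (R : realType) (q : R) (d : measure_display) (T : measurableType d).
Variables (P : probability T R) (S : finType) (F : {set {set S}}).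
Variables (X : S -> {RV P >-> R}) (eps r lam : R).
Hypothesis q_gt0 : 0 < q.
Hypothesis F_neq0 : F != finset.set0.
Hypothesis X_iid : iid_weights q X.
Hypothesis eps_gt0 : 0 < eps.
Hypothesis r_large : Num.sqrt (8 * ln eps^-1 * (ell F)%:R) <= r.
Hypothesis lam_gt0 : 0 < lam.
Hypothesis F_patchable : family_patchable X F r lam eps.

Lemma min_weight_upper_tail L :
    (eps%:E <= P [set w | (min_weight X F w <= L)%R])%E ->
  ((1 - 2 * eps)%:E <= P [set w | (min_weight X F w <=
      (L `^ (q / (q + 1)) + lam `^ (q / (q + 1))) `^ ((q + 1) / q))%R])%E.
Proof.
move=> LP.
have coupled := min_weight_coupled F_neq0 X_iid eps_gt0 LP r_large lam_gt0 F_patchable.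
have := likely_bound_ge0 F_neq0 X_iid eps_gt0 LP; rewrite le_eqVlt => /predU1P[L0|L0].
  (* For [L = 0] the optimal [s] would be 1, outside the open interval. Each level [c > lam] is
     reached with $s = (\lambda/c)^q$, and right continuity gives the limit. *)
  rewrite -L0 powR0 ?gt_eqF ?exponent_gt0 // add0r powR_exponentK ?(ltW lam_gt0) //.
  apply: min_over_le_right_cont => c lamc.
  have c0 : 0 < c by apply: lt_trans lamc.
  have := coupled ((lam / c) `^ q).
  rewrite -L0 mul0r add0r -powRrM mulfV ?gt_eqF // powRr1 ?divr_ge0 ?(ltW c0) ?(ltW lam_gt0) //.
  rewrite invf_div mulrCA divff ?gt_eqF // mulr1; apply.
  rewrite powR_gt0 ?divr_gt0 //= -[ltRHS](powR_1 q).
  apply: gt0_ltr_powR; rewrite ?nnegrE ?divr_ge0 ?ltW //.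
  by rewrite ltr_pdivrMr // mul1r.
rewrite -optimal_split //; apply: coupled.
have xa0 : 0 < L `^ (q / (q + 1)) by rewrite powR_gt0.
have ya0 : 0 < lam `^ (q / (q + 1)) by rewrite powR_gt0.
by rewrite divr_gt0 ?addr_gt0 //= ltr_pdivrMr ?addr_gt0 // mul1r ltrDr.
Qed.

(** The upper deviation, with loss $2\varepsilon$, is the tail bound at [L = m]. The lower one, with
    loss $\varepsilon$, applies the same bound at $m(1-Cx)$ and contradicts the median. *)
Lemma min_weight_near_median m : eps < 1 / 4 ->
    is_median P (min_weight X F) m -> lam <= m ->
  ((1 - 3 * eps)%:E <= P [set w | (`|min_weight X F w - m| / m <=
     deviation_constant q * (lam / m) `^ (q / (q + 1)))%R])%E.
Proof.
move=> eps4 [med1 med2] lam_m; set C := deviation_constant q; set x := (lam / m) `^ _.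
have m0 : 0 < m by apply: lt_le_trans lam_m.
have x0 : 0 < x by rewrite powR_gt0 // divr_gt0.
have C2 : 2 <= C := deviation_constant_ge2 q.
have x1 : x <= 1.
  rewrite -(powR_1 (q / (q + 1))); apply: ge0_ler_powR.
  - exact/ltW/exponent_gt0.
  - by rewrite nnegrE divr_ge0 ?ltW.
  - by rewrite nnegrE.
  - by rewrite ler_pdivrMr // mul1r.
pose M := min_weight X F.
have mM (B : set R) : measurable B -> measurable [set w | B (M w)].
  exact: measurable_min_over_in.
have mMle c : measurable [set w | M w <= c] by exact: measurable_min_over_le.
have upper : ((1 - 2 * eps)%:E <= P [set w | (M w <= m * (1 + C * x))%R])%E.
  apply: le_trans (min_weight_upper_tail (L := m) _) _.
    by apply: le_trans med1; rewrite lee_fin; lra.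
  apply: le_measure; rewrite ?inE //.
  move=> w /= /le_trans; apply; rewrite split_factor //.
  rewrite powR_exponent_mulK ?addr_ge0 ?powR_ge0 ?(ltW m0) //.
  by rewrite ler_wpM2l ?(ltW m0) // upper_deviation // (ltW x0).
have lower : (P [set w | (M w <= m * (1 - C * x))%R] <= eps%:E)%E.
  rewrite leNgt; apply/negP => /ltW epsL.
  have := likely_bound_ge0 F_neq0 X_iid eps_gt0 epsL; rewrite pmulr_rge0 // subr_ge0 => Cx1.
  have := min_weight_upper_tail epsL.
  (* Starting from $m(1-Cx)$, the upper tail bound still ends strictly below the median. *)
  set t := (_ `^ _); have tm : t < m.
    rewrite /t powRM ?subr_ge0 ?(ltW m0) //.
    have -> : lam `^ (q / (q + 1)) = m `^ (q / (q + 1)) * x.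
      by rewrite -powRM ?divr_ge0 ?(ltW m0) ?(ltW lam_gt0) // mulrCA divff ?gt_eqF // mulr1.
    rewrite -mulrDr powR_exponent_mulK ?addr_ge0 ?powR_ge0 ?(ltW m0) ?(ltW x0) //.
    rewrite gtr_pMr //; have := lower_deviation q_gt0 x0 Cx1; rewrite -/C => lowd.
    rewrite -[ltRHS](powR_1 ((q + 1) / q)); apply: gt0_ltr_powR.
    - exact: exponentV_gt0.
    - by rewrite nnegrE addr_ge0 ?powR_ge0 ?(ltW x0).
    - by rewrite nnegrE.
    - by lra.
  have mge : measurable [set w | m <= M w].
    by have := mM _ (measurable_itv `[m, +oo[); under eq_set do rewrite /= in_itv /= andbT.
  (* The disjoint events $M \le t$ and $M \ge m$ would have total mass at least $1 - 2\varepsilon +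
     1/2 > 1$, as $\varepsilon < 1/4$. *)
  move=> tP; have := leeD tP med2; rewrite -measureU //; last first.
    by apply/seteqP; split=> w //= -[wt mw]; have := lt_le_trans tm (le_trans mw wt); rewrite ltxx.
  rewrite -EFinD => /le_trans /(_ (probability_le1 _ (measurableU _ _ (mMle _) mge))).
  by rewrite lee_fin; lra.
set E := [set w | _].
have mE : measurable E.
  have := mM _ (measurable_itv `[m - C * x * m, m + C * x * m]).
  by rewrite /E; under eq_set do rewrite /= in_itv /= -ler_distl -ler_pdivrMr //.
have sub : [set w | M w <= m * (1 + C * x)] `<=` E `|` [set w | M w <= m * (1 - C * x)].
  move=> w /= up; have [|lo] := leP (M w) (m * (1 - C * x)); [by right|left].
  rewrite /E /= ler_pdivrMr // ler_distl; apply/andP; split; rewrite -/M; nra.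
have H : ((1 - 2 * eps)%:E <= P E + eps%:E)%E.
  apply: le_trans upper _; apply: le_trans (leeD2l _ lower).
  apply: le_trans (measureU2 _ mE (mMle _)).
  by apply: le_measure => //; rewrite inE //; exact: measurableU.
rewrite (_ : 1 - 3 * eps = 1 - 2 * eps - eps); last by ring.
by rewrite EFinB leeBlDr.
Qed.

End Tails.

Theorem theorem1 (R : realType) (q : R) (q_gt0 : 0 < q) :
  (forall (d : measure_display) (T : measurableType d) (P : probability T R)
      (S : finType) (F : {set {set S}}) (X : S -> {RV P >-> R})
      (eps L r lam : R),
    F != finset.set0 ->
    iid_weights q X ->
    0 < eps ->
    (eps%:E <= P [set w | (min_weight X F w <= L)%R])%E ->
    Num.sqrt (8 * ln eps^-1 * (ell F)%:R) <= r ->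
    0 < lam ->
    family_patchable X F r lam eps ->
    ((1 - 2 * eps)%:E <=
      P [set w | (min_weight X F w <=
                  (L `^ (q / (q + 1)) + lam `^ (q / (q + 1))) `^ ((q + 1) / q))%R])%E)
  /\
  (exists C : R,
    forall (d : measure_display) (T : measurableType d) (P : probability T R)
      (S : finType) (F : {set {set S}}) (X : S -> {RV P >-> R})
      (eps r lam m : R),
    F != finset.set0 ->
    iid_weights q X ->
    0 < eps ->
    eps < 1 / 4 ->
    Num.sqrt (8 * ln eps^-1 * (ell F)%:R) <= r ->
    0 < lam ->
    family_patchable X F r lam eps ->
    is_median P (min_weight X F) m ->
    lam <= m ->
    ((1 - 3 * eps)%:E <=
      P [set w | (`|min_weight X F w - m| / m <=
                  C * (lam / m) `^ (q / (q + 1)))%R])%E).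
Proof.
split.
  move=> d T P S F X eps L r lam F0 Xiid eps0 LP rl lam0 Fp.
  exact: (min_weight_upper_tail q_gt0 F0 Xiid eps0 rl lam0 Fp LP).
exists (deviation_constant q) => d T P S F X eps r lam m F0 Xiid eps0 eps4 rl lam0 Fp med lm.
exact: (min_weight_near_median q_gt0 F0 Xiid eps0 rl lam0 Fp eps4 med lm).
Qed.
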